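(* Let $G$ be a finitely presented indicable group which does not contain a free semigroup of rank $2$. Then $G$ has the form of a semidirect product $H\rtimes\mathbb{Z}$, where $H$ is a group which has an ascending finite L-presentation.
   Context: A group is called indicable if it admits a homomorphism onto the infinite cyclic group. A group contains a free semigroup of rank $2$ if it has two elements that freely generate a free subsemigroup of rank $2$. For a subset $S$ of a group, $\langle S\rangle^{\#}$ denotes the normal subgroup generated by $S$ (the normal closure of $S$). For a set $\Phi$ of endomorphisms of a group, $\Phi^*$ denotes the monoid generated by $\Phi$, i.e. the closure of $\{1\}\cup\Phi$ under composition, where $1$ is the identity map. An endomorphic presentation (or L-presentation) is an expression $\langle X\mid Q\mid R\mid \Phi\rangle$, where $X$ is a set, $Q,R$ are subsets of the free group $F(X)$ on $X$, and $\Phi$ is a set of endomorphisms of $F(X)$. It defines the group $F(X)/N$, where $N=\langle Q\cup\bigcup_{\phi\in\Phi^*}\phi(R)\rangle^{\#}$. It is called finite if $X,Q,R,\Phi$ are all finite, and ascending if $Q$ is empty. A group ''has'' such a presentation if it is isomorphic to the group the presentation defines. *)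

(* Defs.v *)
From HB Require Import structures.
From mathcomp Require Import all_boot all_order all_algebra.
From mathcomp Require Import boolp classical_sets functions cardinality.

Set Implicit Arguments.
Unset Strict Implicit.
Unset Printing Implicit Defensive.

Local Open Scope classical_set_scope.
Local Open Scope group_scope.

(* A multiplicative map between groups automatically preserves 1 and inverses,
   so {multiplicative G -> H} is the type of group homomorphisms. *)
Definition isomorphic (G H : groupType) : Prop :=
  exists f : {multiplicative G -> H}, bijective f.

(* The letter (x, true) stands for x and (x, false) for its inverse.  The free
   group on X consists of the reduced words, multiplied by concatenation
   followed by cancellation. *)
Section FreeGroup.
Variable X : choiceType.
Implicit Types (a b : X * bool) (u v w : seq (X * bool)).

Definition inv_letter a := (a.1, ~~ a.2).

Fixpoint reduced w : bool :=
  if w is a :: w' then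
    (if w' is b :: _ then b != inv_letter a else true) && reduced w'
  else true.

(* Multiplies a reduced word on the left by a letter. *)
Definition push a w :=
  if w is b :: w' then if b == inv_letter a then w' else a :: w else [:: a].

Definition mul_word u v := foldr push v u.
Definition inv_word u := rev (map inv_letter u).

Record freeGroup := FreeWord {
  word_of :> seq (X * bool);
  _ : reduced word_of
}.

HB.instance Definition _ := [isSub for word_of].
HB.instance Definition _ := [Choice of freeGroup by <:].

Lemma inv_letterK : involutive inv_letter.
Proof. by case=> x b; rewrite /inv_letter negbK. Qed.

Lemma reduced_push a w : reduced w -> reduced (push a w).
Proof.
case: w => [//|b w] /=; case: eqP => [_ /andP[_ //]|/eqP nba rw].
by rewrite /= nba.
Qed.

Lemma reduced_mul u v : reduced v -> reduced (mul_word u v).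
Proof. by move=> rv; elim: u => //= a u IHu; apply: reduced_push. Qed.

Lemma push_inv a w : reduced w -> push a (push (inv_letter a) w) = w.
Proof.
case: w => [|b w] /=; first by rewrite eqxx.
rewrite inv_letterK; case: eqP => [->|_ _]; last by rewrite /= eqxx.
by case: w => [|c w] //= /andP[/negPf->].
Qed.

Lemma push_mul a u v :
  reduced u -> reduced v -> mul_word (push a u) v = push a (mul_word u v).
Proof.
case: u => [//|b u] ru rv /=; case: eqP => [eb|//].
by rewrite eb push_inv // reduced_mul.
Qed.

Lemma mul_wordA u v w : reduced u -> reduced v -> reduced w ->
  mul_word u (mul_word v w) = mul_word (mul_word u v) w.
Proof.
move=> ru rv rw; elim: u ru => //= a u IHu /andP[_ ru].
by rewrite IHu // push_mul // reduced_mul.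
Qed.

Lemma mul_word0 u : reduced u -> mul_word u [::] = u.
Proof.
elim: u => //= a u IHu /andP[hd ru]; rewrite IHu //.
by case: u hd {IHu ru} => //= b u /negPf->.
Qed.

Lemma mul_word_cat u1 u2 v :
  mul_word (u1 ++ u2) v = mul_word u1 (mul_word u2 v).
Proof. exact: foldr_cat. Qed.

Lemma mul_word_inv u v : reduced v -> mul_word (inv_word u) (mul_word u v) = v.
Proof.
elim: u v => [//|a u IHu] v rv; rewrite /inv_word /= rev_cons -cats1.
rewrite mul_word_cat /=; have := push_inv (inv_letter a) (reduced_mul u rv).
by rewrite inv_letterK => ->; exact: IHu.
Qed.

Lemma inv_wordK : involutive inv_word.
Proof.
move=> u; rewrite /inv_word -map_rev revK mapK //; exact: inv_letterK.
Qed.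

Lemma reduced_rcons w a :
  reduced (rcons w a) = reduced w &&
    (if w is b :: w' then a != inv_letter (last b w') else true).
Proof.
elim: w => //= b [|c w] /= IHw; first by rewrite !andbT.
by rewrite IHw andbA.
Qed.

Lemma reduced_inv u : reduced u -> reduced (inv_word u).
Proof.
elim: u => // a u IHu ru; rewrite /inv_word /= rev_cons reduced_rcons.
move: ru => /= /andP[hd ru]; rewrite IHu //=.
case: u hd {IHu ru} => //= b u hd; rewrite rev_cons.
case E: (rcons _ _) => [//|c s]; have: last c (c :: s) = inv_letter b.
  by rewrite -E last_rcons.
move=> /= ->; rewrite inv_letterK; apply: contra hd => /eqP <-.
by [].
Qed.

Definition free_one := @FreeWord [::] isT.
Definition free_mul (u v : freeGroup) : freeGroup :=
  FreeWord (reduced_mul u (valP v)).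
Definition free_inv (u : freeGroup) : freeGroup :=
  FreeWord (reduced_inv (valP u)).

Lemma free_mulA : associative free_mul.
Proof. by move=> u v w; apply/val_inj/mul_wordA; exact: valP. Qed.

Lemma free_mul1 : left_id free_one free_mul.
Proof. by move=> u; apply/val_inj. Qed.

Lemma free_mulr1 : right_id free_one free_mul.
Proof. by move=> u; apply/val_inj/mul_word0/valP. Qed.

Lemma free_mulV : left_inverse free_one free_inv free_mul.
Proof.
move=> u; apply/val_inj; rewrite /= -[X in mul_word _ X](mul_word0 (valP u)).
exact: mul_word_inv.
Qed.

Lemma free_mulrV : right_inverse free_one free_inv free_mul.
Proof.
move=> u; rewrite -[X in free_mul X _](_ : free_inv (free_inv u) = u).
  exact: free_mulV.
exact/val_inj/inv_wordK.
Qed.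

HB.instance Definition _ := isGroup.Build freeGroup
  free_mulA free_mul1 free_mulr1 free_mulV free_mulrV.

End FreeGroup.

Record normalSubgroup (G : groupType) := NormalSubgroup {
  nsg_set :> set G;
  nsg1 : nsg_set 1;
  nsgM : forall x y, nsg_set x -> nsg_set y -> nsg_set (x * y);
  nsgV : forall x, nsg_set x -> nsg_set x^-1;
  nsgJ : forall x y, nsg_set x -> nsg_set (x ^ y)
}.

Section NormalClosure.
Variables (G : groupType) (S : set G).

Definition ncl : set G :=
  [set x | forall N : normalSubgroup G, S `<=` N -> nsg_set N x].

Lemma ncl1 : ncl 1. Proof. by move=> N _; exact: nsg1. Qed.
Lemma nclM x y : ncl x -> ncl y -> ncl (x * y).
Proof. by move=> nx ny N SN; apply: nsgM; [exact: nx|exact: ny]. Qed.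
Lemma nclV x : ncl x -> ncl x^-1.
Proof. by move=> nx N SN; apply: nsgV; exact: nx. Qed.
Lemma nclJ x y : ncl x -> ncl (x ^ y).
Proof. by move=> nx N SN; apply: nsgJ; exact: nx. Qed.

Definition normal_closure := @NormalSubgroup G ncl ncl1 nclM nclV nclJ.

End NormalClosure.

Section Quotient.
Local Open Scope quotient_scope.
Variables (G : groupType) (N : normalSubgroup G).

Definition coset_rel (x y : G) : bool := `[< nsg_set N (x^-1 * y) >].

Lemma coset_rel_refl : reflexive coset_rel.
Proof. by move=> x; apply/asboolP; rewrite mulVg; exact: nsg1. Qed.

Lemma coset_rel_sym : symmetric coset_rel.
Proof.
by move=> x y; apply/asboolP/asboolP => /nsgV; rewrite invgM invgK.
Qed.

Lemma coset_rel_trans : transitive coset_rel.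
Proof.
move=> y x z /asboolP Nxy /asboolP Nyz; apply/asboolP.
by have := nsgM Nxy Nyz; rewrite mulgA mulgK.
Qed.

Canonical coset_equiv :=
  EquivRel coset_rel coset_rel_refl coset_rel_sym coset_rel_trans.

Definition quotientGroup := {eq_quot coset_equiv}.
HB.instance Definition _ := Choice.on quotientGroup.
HB.instance Definition _ := EqQuotient.on quotientGroup.

Definition quot_one : quotientGroup := \pi_quotientGroup 1.
Definition quot_mul (x y : quotientGroup) : quotientGroup :=
  \pi_quotientGroup (repr x * repr y).
Definition quot_inv (x : quotientGroup) : quotientGroup :=
  \pi_quotientGroup (repr x)^-1.

Lemma coset_eqP (x y : G) :
  reflect (\pi_quotientGroup x = \pi_quotientGroup y) (coset_rel x y).
Proof. by apply: (iffP idP) => [xy|/eqP]; [apply/eqP|]; rewrite eqmodE. Qed.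

Lemma quot_reprP (x : G) : coset_rel (repr (\pi_quotientGroup x)) x.
Proof. by apply/coset_eqP; rewrite reprK. Qed.

Lemma quot_mulE (x y : G) :
  quot_mul (\pi_quotientGroup x) (\pi_quotientGroup y) =
  \pi_quotientGroup (x * y).
Proof.
have /asboolP Nx := quot_reprP x; have /asboolP Ny := quot_reprP y.
apply/coset_eqP/asboolP; have := nsgM (nsgJ y Nx) (nsgJ 1 Ny).
set x' := repr _; set y' := repr _.
rewrite conjg1 => /(nsgJ (y^-1 * y')); rewrite /conjg => H.
suff -> : (x' * y')^-1 * (x * y) =
  (y^-1 * y')^-1 * (y^-1 * (x'^-1 * x * y) * (y'^-1 * y) * (y^-1 * y')) by [].
by rewrite !invgM !invgK !mulgA !mulgK !mulgVK.
Qed.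

Lemma quot_invE (x : G) :
  quot_inv (\pi_quotientGroup x) = \pi_quotientGroup x^-1.
Proof.
have /asboolP /nsgV Nx := quot_reprP x.
apply/coset_eqP/asboolP; have := nsgJ x^-1 Nx.
by rewrite /conjg !invgM !invgK !mulgA mulgV mul1g.
Qed.

Lemma quot_mulA : associative quot_mul.
Proof.
move=> x y z; rewrite -[x]reprK -[y]reprK -[z]reprK.
rewrite (quot_mulE (repr y) (repr z)) (quot_mulE (repr x) (repr y)).
by rewrite !quot_mulE mulgA.
Qed.

Lemma quot_mul1 : left_id quot_one quot_mul.
Proof. by move=> x; rewrite -[x]reprK quot_mulE mul1g. Qed.

Lemma quot_mulr1 : right_id quot_one quot_mul.
Proof. by move=> x; rewrite -[x]reprK quot_mulE mulg1. Qed.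

Lemma quot_mulV : left_inverse quot_one quot_inv quot_mul.
Proof. by move=> x; rewrite -[x]reprK quot_invE quot_mulE mulVg. Qed.

Lemma quot_mulrV : right_inverse quot_one quot_inv quot_mul.
Proof. by move=> x; rewrite -[x]reprK quot_invE quot_mulE mulgV. Qed.

HB.instance Definition _ := isGroup.Build quotientGroup
  quot_mulA quot_mul1 quot_mulr1 quot_mulV quot_mulrV.

End Quotient.

(* Each act_fun a is an automorphism of K: its inverse is act_fun a^-1. *)
Record autAction (A K : groupType) := AutAction {
  act_fun :> A -> {multiplicative K -> K};
  act1 : forall k, act_fun 1 k = k;
  actM : forall a b k, act_fun (a * b) k = act_fun a (act_fun b k)
}.

(* The external semidirect product K ><| A, where (k, a) stands for k * a. *)
Section SemidirectProduct.
Variables (A K : groupType) (theta : autAction A K).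

Definition semidirect of autAction A K : Type := (K * A)%type.
Local Notation sdT := (semidirect theta).

HB.instance Definition _ := Choice.copy sdT (K * A)%type.

Definition sd_one : sdT := (1, 1).
Definition sd_mul (x y : sdT) : sdT := (x.1 * theta x.2 y.1, x.2 * y.2).
Definition sd_inv (x : sdT) : sdT := (theta x.2^-1 x.1^-1, x.2^-1).

Let theta1 a : theta a 1 = 1.
Proof. by apply: (@mulgI _ (theta a 1)); rewrite -gmulfM !mulg1. Qed.

Lemma sd_mulA : associative sd_mul.
Proof. by move=> x y z; rewrite /sd_mul /= gmulfM actM !mulgA. Qed.

Lemma sd_mul1 : left_id sd_one sd_mul.
Proof. by case=> k a; rewrite /sd_mul /= act1 !mul1g. Qed.

Lemma sd_mulr1 : right_id sd_one sd_mul.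
Proof. by case=> k a; rewrite /sd_mul /= theta1 !mulg1. Qed.

Lemma sd_mulV : left_inverse sd_one sd_inv sd_mul.
Proof. by case=> k a; rewrite /sd_mul /= -gmulfM !mulVg theta1. Qed.

Lemma sd_mulrV : right_inverse sd_one sd_inv sd_mul.
Proof. by case=> k a; rewrite /sd_mul /= -actM !mulgV act1 mulgV. Qed.

HB.instance Definition _ := isGroup.Build sdT
  sd_mulA sd_mul1 sd_mulr1 sd_mulV sd_mulrV.

End SemidirectProduct.

(* The infinite cyclic group, written multiplicatively. *)
Definition Zgroup : groupType := Algebra.to_multiplicative int.

Definition indicable (G : groupType) : Prop :=
  exists f : {multiplicative G -> Zgroup}, forall z, exists g, f g = z.

Definition finitely_presented (G : groupType) : Prop :=
  exists (X : finType) (R : set (freeGroup X)),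
    finite_set R /\ isomorphic G (quotientGroup (normal_closure R)).

(* Elements of the free semigroup of rank 2 are the nonempty words over bool. *)
Definition contains_free_semigroup2 (G : groupType) : Prop :=
  exists a b : G, forall u v : seq bool, u != [::] -> v != [::] ->
    \prod_(c <- u) (if c then a else b) = \prod_(c <- v) (if c then a else b) ->
    u = v.

(* The closure of {1} and Phi under composition. *)
Inductive endo_monoid (F : groupType) (Phi : set {multiplicative F -> F}) :
    set (F -> F) :=
  | endo_id : endo_monoid Phi idfun
  | endo_gen (phi : {multiplicative F -> F}) : Phi phi -> endo_monoid Phi phi
  | endo_comp (f g : F -> F) :
      endo_monoid Phi f -> endo_monoid Phi g -> endo_monoid Phi (f \o g).

Record Lpresentation := {
  lp_X : choiceType;
  lp_Q : set (freeGroup lp_X);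
  lp_R : set (freeGroup lp_X);
  lp_Phi : set {multiplicative freeGroup lp_X -> freeGroup lp_X}
}.

Arguments lp_Q : clear implicits.
Arguments lp_R : clear implicits.
Arguments lp_Phi : clear implicits.

Definition lp_group (P : Lpresentation) : groupType :=
  quotientGroup (normal_closure
    (lp_Q P `|` \bigcup_(phi in endo_monoid (lp_Phi P)) (phi @` lp_R P))).

Definition lp_finite (P : Lpresentation) : Prop :=
  [/\ finite_set [set: lp_X P], finite_set (lp_Q P), finite_set (lp_R P)
    & finite_set (lp_Phi P)].

Definition lp_ascending (P : Lpresentation) : Prop := lp_Q P = set0.

Definition has_ascending_finite_Lpresentation (H : groupType) : Prop :=
  exists P : Lpresentation,
    [/\ lp_finite P, lp_ascending P & isomorphic H (lp_group P)].

(* Main.v *)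
From HB Require Import structures.
Require Import Defs.
From mathcomp Require Import all_boot.
From mathcomp Require Import all_algebra boolp classical_sets cardinality.

Set Implicit Arguments.
Unset Strict Implicit.
Unset Printing Implicit Defensive.

Import GRing.Theory.

Local Open Scope classical_set_scope.
Local Open Scope group_scope.

(** Let [f] map [G] onto the integers, with [f t = 1].

    First, [ker f] is finitely generated.  If [f a = 1], the elements [t] and
    [t * a] satisfy a nontrivial relation between positive words, and [f] shows
    that the two words have the same length.  Moving all powers of [t] to the
    left turns a positive word of length [n] into [t ^+ n] times a product of
    distinct conjugates [a ^ (t ^+ j)] with [j < n], so at the first letter
    where the two words differ the relation expresses one conjugate
    [a ^ (t ^+ k)] through those with [j < k]; conjugating by [t], these
    generate all conjugates with nonnegative exponent.  The same argument for
    [t^-1] handles the others ([positive_conjugates], [conjugates_fg]).  Each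
    generator of [G] is some [a] with [f a = 1] times a power of [t], and the
    conjugates of these finitely many [a] by powers of [t] generate [ker f]
    ([kernel_fg]).

    Next, let [theta] map a free group [F] of finite rank onto [ker f], and
    choose endomorphisms [phi], [psi] of [F] that lift conjugation by [t^-1]
    and by [t].  For any finite [R] in [ker theta] containing the relators
    which say that [phi] and [psi] are mutually inverse, let [N_R] be the
    normal closure of the images of [R] under the monoid generated by [phi]
    and [psi].  Then [phi] induces an automorphism of [F / N_R], and the
    semidirect product of [F / N_R] by the integers (the mapping torus of
    [phi]) maps onto [G].  It remains to choose [R] with [N_R = ker theta].
    With only the inverse relators, the mapping torus is a finitely generated
    group mapping onto the finitely presented group [G], so the kernel is the
    normal closure of a finite set ([kernel_finite_ncl]).  This kernel lies
    over [0], so its generators lift to [F]; adding these lifts to [R] kills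
    the kernel ([cyclic_extension]). *)

(** * Homomorphisms and generated subgroups *)

Section Homomorphisms.
Variables G H : groupType.

Definition mk_hom (f : G -> H) (fM : {morph f : x y / x * y}) :
  {multiplicative G -> H} := HB.pack f (isMultiplicative.Build G H f fM).

Variable f : {multiplicative G -> H}.

Lemma hom1 : f 1 = 1.
Proof. by apply: (@mulgI _ (f 1)); rewrite -gmulfM !mulg1. Qed.

Lemma homV x : f x^-1 = (f x)^-1.
Proof. by apply: (@mulgI _ (f x)); rewrite -gmulfM !mulgV hom1. Qed.

Lemma homJ x y : f (x ^ y) = f x ^ f y.
Proof. by rewrite /conjg !gmulfM homV. Qed.

Lemma homX x n : f (x ^+ n) = f x ^+ n.
Proof. by elim: n => [|n IHn]; rewrite ?hom1 // !expgS gmulfM IHn. Qed.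

Lemma hom_divP x y : f (x^-1 * y) = 1 <-> f x = f y.
Proof.
rewrite gmulfM homV; split=> [|->]; last exact: mulVg.
by move/mulg1_eq; rewrite invgK.
Qed.

Lemma hom_inj : (forall x, f x = 1 -> x = 1) -> injective f.
Proof. by move=> fI x y /hom_divP/fI/mulg1_eq; rewrite invgK. Qed.

Definition kernel : normalSubgroup G.
Proof.
exists [set x | f x = 1] => /=.
- exact: hom1.
- by move=> x y fx fy; rewrite gmulfM fx fy mulg1.
- by move=> x fx; rewrite homV fx invg1.
- by move=> x y fx; rewrite homJ fx conj1g.
Defined.

Definition preim_nsg (M : normalSubgroup H) : normalSubgroup G.
Proof.
exists [set x | nsg_set M (f x)] => /=.
- rewrite hom1; exact: nsg1.
- by move=> x y Mx My; rewrite gmulfM; exact: nsgM.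
- by move=> x Mx; rewrite homV; exact: nsgV.
- by move=> x y Mx; rewrite homJ; exact: nsgJ.
Defined.

End Homomorphisms.

Section Generated.
Variables (G : groupType).
Implicit Types S T : set G.

Inductive generated S : set G :=
  | generated1 : generated S 1
  | generated_in x : S x -> generated S x
  | generatedM x y : generated S x -> generated S y -> generated S (x * y)
  | generatedV x : generated S x -> generated S x^-1.

Lemma generated_sub S T : S `<=` generated T -> generated S `<=` generated T.
Proof.
move=> ST x; elim=> {x} [|x /ST//|x y _ IHx _ IHy|x _ IHx].
- exact: generated1.
- exact: generatedM.
- exact: generatedV.
Qed.

Lemma eq_hom_generated (H : groupType) (f g : {multiplicative G -> H}) S :
  {in S, f =1 g} -> {in generated S, f =1 g}.
Proof.
move=> fg x; rewrite inE; elim=> {x} [|x Sx|x y _ IHx _ IHy|x _ IHx].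
- by rewrite !hom1.
- by rewrite fg ?inE.
- by rewrite !gmulfM IHx IHy.
- by rewrite !homV IHx.
Qed.

End Generated.

Lemma generated_hom (G H : groupType) (f : {multiplicative G -> H})
    (S : set G) (T : set H) :
  (forall x, S x -> generated T (f x)) ->
  forall x, generated S x -> generated T (f x).
Proof.
move=> ST x; elim=> {x} [|x /ST//|x y _ IHx _ IHy|x _ IHx].
- rewrite hom1; exact: generated1.
- rewrite gmulfM; exact: generatedM.
- rewrite homV; exact: generatedV.
Qed.

Lemma generatedJ (G : groupType) (S : set G) t :
  (forall x, S x -> generated S (x ^ t)) ->
  forall x, generated S x -> generated S (x ^ t).
Proof.
move=> SJ; have JM : {morph (fun x : G => x ^ t) : x y / x * y}.
  by move=> x y; exact: conjMg.
exact: (generated_hom (f := mk_hom JM)).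
Qed.

(** * Free groups and quotients *)

Section FreeLift.
Variables (X : choiceType) (G : groupType) (g : X -> G).

Definition letter_value (a : X * bool) := if a.2 then g a.1 else (g a.1)^-1.
Definition word_value w := \prod_(a <- w) letter_value a.

Lemma word_value_push a w :
  word_value (push a w) = letter_value a * word_value w.
Proof.
case: w => [|b w] /=; first by rewrite /word_value big_seq1 big_nil mulg1.
case: eqP => [->|_]; last by rewrite /word_value big_cons.
rewrite /word_value big_cons /letter_value /=.
by case: (a.2); rewrite /= ?mulVKg ?mulKg.
Qed.

Lemma free_liftM :
  {morph (fun w : freeGroup X => word_value w) : u v / u * v}.
Proof.
move=> [u ru] v /=; elim: u {ru} => [|a w IHw] /=.
  by rewrite [word_value [::]]/word_value big_nil mul1g.
by rewrite word_value_push IHw mulgA [word_value (a :: w)]/word_value big_cons.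
Qed.

Definition free_lift := mk_hom free_liftM.

Definition free_gen (x : X) : freeGroup X := @FreeWord X [:: (x, true)] isT.

Lemma free_liftE x : free_lift (free_gen x) = g x.
Proof. by rewrite /= /word_value big_seq1. Qed.

End FreeLift.

Lemma push_reduced (X : choiceType) (a : X * bool) w :
  reduced (a :: w) -> push a w = a :: w.
Proof. by case: w => //= b w /andP[/negPf ->]. Qed.

Lemma free_generated (X : choiceType) (w : freeGroup X) :
  generated (range (@free_gen X)) w.
Proof.
case: w => w; elim: w => [|[x b] w IHw] rw.
  rewrite (_ : FreeWord _ = 1); [exact: generated1 | exact: val_inj].
have rw' : reduced w by case/andP: rw.
have -> : FreeWord rw =
    (if b then free_gen x else (free_gen x)^-1) * FreeWord rw'.
  by apply: val_inj; case: b rw => rw /=; rewrite push_reduced.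
apply: generatedM => //.
have gx : generated (range (@free_gen X)) (free_gen x).
  by apply: generated_in; exists x.
by case: b {rw} => //; exact: generatedV.
Qed.

Section QuotientMaps.
Variables (G : groupType) (N : normalSubgroup G).

Definition quot_proj : {multiplicative G -> quotientGroup N} :=
  mk_hom (fun x y => esym (quot_mulE N x y)).

Lemma quot_projE x : quot_proj x = 1 <-> nsg_set N x.
Proof.
split=> [/esym /coset_eqP/asboolP|Nx]; first by rewrite invg1 mul1g.
by apply/esym/coset_eqP/asboolP; rewrite invg1 mul1g.
Qed.

Lemma quot_proj_surj y : exists x, quot_proj x = y.
Proof. by exists (repr y); exact: reprK. Qed.

Variables (H : groupType) (f : {multiplicative G -> H}).
Hypothesis Nf : forall x, nsg_set N x -> f x = 1.

Lemma quot_repr_val x : f (repr (quot_proj x)) = f x.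
Proof. by apply/hom_divP/Nf/asboolP/quot_reprP. Qed.

Lemma quot_liftM :
  {morph (fun y : quotientGroup N => f (repr y)) : x y / x * y}.
Proof.
move=> x y; case: (quot_proj_surj x) (quot_proj_surj y) => u <- [v <-].
by rewrite -gmulfM !quot_repr_val gmulfM.
Qed.

Definition quot_lift := mk_hom quot_liftM.

Lemma quot_liftE x : quot_lift (quot_proj x) = f x.
Proof. exact: quot_repr_val. Qed.

End QuotientMaps.

(** * Integer powers and mapping tori *)

Lemma int_ind_succ (P : int -> Prop) :
  P 0%R -> (forall z, P z -> P (1 + z)%R) -> (forall z, P z -> P (-1 + z)%R) ->
  forall z, P z.
Proof.
move=> P0 PS PP; elim/int_ind=> // n Pn.
  by rewrite -addn1 PoszD addrC; apply: PS.
by rewrite -addn1 PoszD opprD addrC; apply: PP.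
Qed.

(** The action of the integers on the powers of one bijection underlies both
    integer powers of a group element and the action in a mapping torus. *)
Section IntegerIteration.
Variables (T : Type) (f g : T -> T).
Hypotheses (fK : cancel f g) (gK : cancel g f).

Definition iterz (z : int) : T -> T :=
  match z with Posz n => iter n f | Negz n => iter n.+1 g end.

Lemma iterzS z x : iterz (1 + z) x = f (iterz z x).
Proof. by case: z => [n|[|n]] //=; rewrite gK // subn1. Qed.

Lemma iterzP z x : iterz (-1 + z) x = g (iterz z x).
Proof. by rewrite -[z in RHS](addNKr 1%R) iterzS fK. Qed.

Lemma iterzD y z x : iterz (y + z) x = iterz y (iterz z x).
Proof.
elim/int_ind_succ: y => [|y IHy|y IHy]; first by rewrite add0r.
- by rewrite -addrA !iterzS IHy.
- by rewrite -addrA !iterzP IHy.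
Qed.

End IntegerIteration.

Lemma iterz_morph (T T' : Type) (h : T -> T') f g f' g' :
  (forall x, h (f x) = f' (h x)) -> (forall x, h (g x) = g' (h x)) ->
  forall z x, h (iterz f g z x) = iterz f' g' z (h x).
Proof. by move=> hf hg [n|n] x; elim: n => //= n <-. Qed.

Section CyclicPowers.
Variables (G : groupType) (t : G).

Let tK : cancel ( *%g t) ( *%g t^-1). Proof. exact: mulKg. Qed.
Let tVK : cancel ( *%g t^-1) ( *%g t). Proof. exact: mulVKg. Qed.

Lemma zpowM :
  {morph (fun z : Zgroup => iterz ( *%g t) ( *%g t^-1) z 1) : y z / y * z}.
Proof.
move=> y z; rewrite (iterzD tK tVK) -[X in iterz _ _ y X]mul1g.
pose r x := x * iterz ( *%g t) ( *%g t^-1) z 1.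
by apply/esym/(iterz_morph (h := r)) => x; rewrite /r mulgA.
Qed.

Definition zpow := mk_hom zpowM.

Lemma zpow1 : zpow (1%R : int) = t. Proof. exact: mulg1. Qed.

End CyclicPowers.

Lemma Zgroup_generated (z : Zgroup) : generated [set (1%R : int) : Zgroup] z.
Proof.
have g1 : generated [set (1%R : int) : Zgroup] (1%R : int).
  exact: generated_in.
elim/int_ind_succ: z => [|z IHz|z IHz]; first exact: generated1.
- exact: (generatedM g1).
- exact: (generatedM (generatedV g1)).
Qed.

(** The conditions under which [phi] and [psi] induce mutually inverse
    automorphisms of [F / N]. *)
Record inverse_modulo (F : groupType) (N : normalSubgroup F)
    (phi psi : {multiplicative F -> F}) : Prop := InverseModulo {
  inv_mod_l : forall x, nsg_set N x -> nsg_set N (phi x);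
  inv_mod_r : forall x, nsg_set N x -> nsg_set N (psi x);
  inv_mod_lr : forall x, nsg_set N (x^-1 * phi (psi x));
  inv_mod_rl : forall x, nsg_set N (x^-1 * psi (phi x))
}.

Section MappingTorus.
Variables (F : groupType) (N : normalSubgroup F).
Variables (phi psi : {multiplicative F -> F}).
Hypothesis inv_phi : inverse_modulo N phi psi.

Let projN := quot_proj N.

Lemma proj_phi x : nsg_set N x -> (projN \o phi) x = 1.
Proof. by move=> Nx; apply/quot_projE/(inv_mod_l inv_phi). Qed.

Lemma proj_psi x : nsg_set N x -> (projN \o psi) x = 1.
Proof. by move=> Nx; apply/quot_projE/(inv_mod_r inv_phi). Qed.

Definition quot_phi := quot_lift proj_phi.
Definition quot_psi := quot_lift proj_psi.

Lemma quot_phiE x : quot_phi (projN x) = projN (phi x).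
Proof. exact: (quot_liftE proj_phi). Qed.

Lemma quot_psiE x : quot_psi (projN x) = projN (psi x).
Proof. exact: (quot_liftE proj_psi). Qed.

Lemma quot_phiK : cancel quot_phi quot_psi.
Proof.
move=> y; have [x <-] := quot_proj_surj y; rewrite quot_phiE quot_psiE.
by apply/esym/hom_divP/quot_projE/(inv_mod_rl inv_phi).
Qed.

Lemma quot_psiK : cancel quot_psi quot_phi.
Proof.
move=> y; have [x <-] := quot_proj_surj y; rewrite quot_psiE quot_phiE.
by apply/esym/hom_divP/quot_projE/(inv_mod_lr inv_phi).
Qed.

Lemma torus_actM (z : Zgroup) : {morph iterz quot_phi quot_psi z : x y / x * y}.
Proof.
have iterM n (f : {multiplicative quotientGroup N -> quotientGroup N}) :
    {morph iter n f : x y / x * y}.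
  by move=> x y; elim: n => //= n ->; rewrite gmulfM.
by case: z => n; exact: iterM.
Qed.

Definition torus_action : autAction Zgroup (quotientGroup N) :=
  @AutAction Zgroup _ (fun z => mk_hom (torus_actM z)) (fun=> erefl)
    (iterzD quot_phiK quot_psiK).

Definition torus := semidirect torus_action.

Lemma torus_projM :
  {morph (fun x => (projN x, 1) : torus) : x y / x * y}.
Proof. by move=> x y; congr pair; rewrite gmulfM. Qed.

Definition torus_proj := mk_hom torus_projM.

Lemma torus_shiftM : {morph (fun z => (1, z) : torus) : y z / y * z}.
Proof. by move=> y z; congr pair; rewrite hom1 mul1g. Qed.

Definition torus_shift : {multiplicative Zgroup -> torus} :=
  mk_hom torus_shiftM.

Lemma torus_split (y : torus) : y = torus_proj (repr y.1) * torus_shift y.2.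
Proof.
case: y => k z; congr pair; last exact/esym/mul1g.
by rewrite -[LHS](reprK k); apply/esym/mulg1.
Qed.

Lemma torus_projE x : torus_proj x = 1 <-> nsg_set N x.
Proof.
split=> [[px]|/quot_projE px]; first exact/quot_projE.
by congr pair.
Qed.

Lemma torus_proj_phi x :
  torus_proj (phi x) = torus_proj x ^ (torus_shift (1%R : int))^-1.
Proof.
suff shift_proj : torus_shift (1%R : int) * torus_proj x =
    torus_proj (phi x) * torus_shift (1%R : int).
  by rewrite /conjg invgK mulgA shift_proj mulgK.
congr pair; rewrite [LHS]mul1g [RHS]mulg1; exact: quot_phiE.
Qed.

Lemma torus_proj_psi x :
  torus_proj (psi x) = torus_proj x ^ torus_shift (1%R : int).
Proof.
have -> : torus_proj x = torus_proj (phi (psi x)).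
  by apply/hom_divP/torus_projE/(inv_mod_lr inv_phi).
by rewrite torus_proj_phi conjgKV.
Qed.

(** The universal property of the semidirect product; it gives both the map of
    the torus onto [G] and the maps between the tori of two normal subgroups
    of [F]. *)
Section TorusLift.
Variables (G : groupType) (theta : {multiplicative F -> G}).
Variable tau : {multiplicative Zgroup -> G}.
Hypothesis theta_N : forall x, nsg_set N x -> theta x = 1.
Hypothesis theta_phi :
  forall x, theta (phi x) = theta x ^ (tau (1%R : int))^-1.
Hypothesis theta_psi : forall x, theta (psi x) = theta x ^ tau (1%R : int).

Let lift := quot_lift theta_N.

Lemma torus_lift_act z y : lift (torus_action z y) = lift y ^ (tau z)^-1.
Proof.
have lift_phi x : lift (quot_phi x) = lift x ^ (tau (1%R : int))^-1.
  by have [u <-] := quot_proj_surj x; rewrite quot_phiE !quot_liftE.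
have lift_psi x : lift (quot_psi x) = lift x ^ (tau (1%R : int)).
  by have [u <-] := quot_proj_surj x; rewrite quot_psiE !quot_liftE.
elim/int_ind_succ: z => [|z IHz|z IHz].
- by rewrite act1 hom1 invg1 conjg1.
- rewrite [torus_action _ _](iterzS quot_psiK) lift_phi IHz -conjgM.
  by rewrite -invgM -gmulfM.
- rewrite [torus_action _ _](iterzP quot_phiK quot_psiK) lift_psi IHz.
  by rewrite -conjgM -[tau 1%R]invgK -(homV tau (1%R : int)) -invgM -gmulfM.
Qed.

Lemma torus_liftM :
  {morph (fun y : torus => lift y.1 * tau y.2) : x y / x * y}.
Proof.
move=> x y; rewrite !gmulfM torus_lift_act /conjg invgK !mulgA.
by rewrite mulgVK.
Qed.

Definition torus_lift : {multiplicative torus -> G} := mk_hom torus_liftM.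

Lemma torus_liftE x z :
  torus_lift (torus_proj x * torus_shift z) = theta x * tau z.
Proof.
rewrite -(quot_liftE theta_N) -/lift -[z in RHS]mul1g -[projN x]mulg1.
by [].
Qed.

End TorusLift.
End MappingTorus.
(** * Finitely presented groups *)

Lemma fp_cover (G : groupType) : finitely_presented G ->
  exists (X : finType) (R : set (freeGroup X))
    (p : {multiplicative freeGroup X -> G}),
    [/\ finite_set R, forall g, exists w, p w = g
      & forall w, p w = 1 <-> ncl R w].
Proof.
move=> [X [R [finR [e [e' eK e'K]]]]].
pose p := mk_hom (can2_gmulfM eK e'K) \o quot_proj (normal_closure R).
exists X, R, p; split=> // [g|w].
  by have [w pw] := quot_proj_surj (e g); exists w; rewrite -[RHS]eK -pw.
split=> [pw1|/(quot_projE (normal_closure R)) Rw].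
  apply/(quot_projE (normal_closure R))/(can_inj e'K).
  by rewrite [LHS]pw1 -(hom1 e) eK.
by apply: (can_inj eK); rewrite e'K hom1.
Qed.

Lemma ncl_sub (G : groupType) (S : set G) : S `<=` ncl S.
Proof. by move=> x Sx N; apply. Qed.

(** Lifting the generators of [G] to [Gam] gives a map [s] from the free group;
    modulo the images of the relators of [G] and the relators making each
    generator of [Gam] equal to a word in the lifted ones, [s] is onto and
    factors through [G], hence inverts [q]. *)
Lemma kernel_finite_ncl (G Gam : groupType) (A : set Gam)
    (q : {multiplicative Gam -> G}) :
  finitely_presented G -> finite_set A -> (forall x, generated A x) ->
  (forall g, exists x, q x = g) ->
  exists S : set Gam, finite_set S /\ forall x, q x = 1 <-> ncl S x.
Proof.
move=> /fp_cover[X [R [p [finR p_surj kerp]]]] finA genA q_surj.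
have [s0 qs0] := choice (fun x => q_surj (p (free_gen x))).
pose s := free_lift s0.
have qs w : q (s w) = p w.
  apply: (eq_hom_generated (f := q \o s) (S := range (@free_gen X))).
    by move=> _ /set_mem [x _ <-]; rewrite -qs0 -(free_liftE s0).
  by rewrite inE; exact: free_generated.
have [w0 pw0] := choice (fun x => p_surj (q x)).
pose S := (s @` R) `|` [set x^-1 * s (w0 x) | x in A].
have qS x : ncl S x -> q x = 1.
  move/(_ (kernel q)); apply=> y [[r Rr <-]|[a _ <-]] /=.
    by rewrite qs; apply/kerp/ncl_sub.
  by apply/hom_divP; rewrite qs pw0.
exists S; split=> [|x].
  by rewrite finite_setU; split; exact: finite_image.
split=> [qx1|]; last exact: qS.
pose pi := quot_proj (normal_closure S).
have ncl_s w : ncl R w -> pi (s w) = 1.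
  move/(_ (kernel (pi \o s))); apply=> r Rr /=.
  by apply/quot_projE/ncl_sub; left; exists r.
have [w pix] : exists w, pi x = pi (s w).
  elim: {x qx1} (genA x) => [|a Aa|x y _ [u xu] _ [v yv]|x _ [u xu]].
  - by exists 1; rewrite !hom1.
  - by exists (w0 a); apply/hom_divP/quot_projE/ncl_sub; right; exists a.
  - by exists (u * v); rewrite !gmulfM xu yv.
  - by exists u^-1; rewrite !homV xu.
apply/(quot_projE (normal_closure S)); rewrite -/pi pix; apply/ncl_s/kerp.
rewrite -qs -qx1; apply/esym/hom_divP/qS.
exact/(quot_projE (normal_closure S))/hom_divP.
Qed.

(** * Ascending L-presentations *)

(** [lp_normal] is, literally, the normal subgroup in an L-presentation whose
    first set of relators is empty; it is the least normal subgroup containing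
    [R] that is mapped into itself by [Phi] ([lp_normal_sub],
    [lp_normal_stable], [lp_normal_min]). *)
Section AscendingRelators.
Variables (F : groupType) (Phi : set {multiplicative F -> F}) (R : set F).

Definition lp_normal : normalSubgroup F :=
  normal_closure
    (set0 `|` \bigcup_(phi in endo_monoid Phi) (phi @` R)).

Lemma lp_normal_sub : R `<=` lp_normal.
Proof.
by move=> x Rx; apply: ncl_sub; right; exists idfun; [exact: endo_id|exists x].
Qed.

Lemma lp_normal_stable (phi : {multiplicative F -> F}) x :
  Phi phi -> nsg_set lp_normal x -> nsg_set lp_normal (phi x).
Proof.
move=> Phi_phi /(_ (preim_nsg phi lp_normal)); apply=> _ [//|[f Mf [r Rr <-]]].
apply: ncl_sub; right; exists (phi \o f); last by exists r.
by apply: endo_comp => //; exact: endo_gen.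
Qed.

Lemma lp_normal_min (M : normalSubgroup F) :
  (forall (phi : {multiplicative F -> F}) x,
     Phi phi -> nsg_set M x -> nsg_set M (phi x)) ->
  R `<=` M -> lp_normal `<=` M.
Proof.
move=> PhiM RM x; apply=> _ [//|[f Mf [r /RM Mr <-]]] {x RM}.
elim: Mf r Mr => [//|phi Phi_phi|g h _ IHg _ IHh] r Mr /=.
- exact: PhiM.
- exact/IHg/IHh.
Qed.

End AscendingRelators.

Section TorusRelators.
Variables (I : choiceType).
Variables (phi psi : {multiplicative freeGroup I -> freeGroup I}).

Definition inverse_relators : set (freeGroup I) :=
  range (fun i => (free_gen i)^-1 * phi (psi (free_gen i)))
  `|` range (fun i => (free_gen i)^-1 * psi (phi (free_gen i))).

Lemma hom_trivial_on_gens (N : normalSubgroup (freeGroup I))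
    (f : {multiplicative freeGroup I -> freeGroup I}) :
  (forall i, nsg_set N ((free_gen i)^-1 * f (free_gen i))) ->
  forall x, nsg_set N (x^-1 * f x).
Proof.
move=> Nf x; apply/quot_projE/hom_divP.
apply: (eq_hom_generated (f := quot_proj N) (g := quot_proj N \o f)
  (S := range (@free_gen I))).
  by move=> _ /set_mem [i _ <-]; apply/hom_divP/quot_projE.
by rewrite inE; exact: free_generated.
Qed.

Lemma lp_inverse_modulo R : inverse_relators `<=` R ->
  inverse_modulo (lp_normal [set phi; psi] R) phi psi.
Proof.
move=> subR; split=> x.
- by apply: lp_normal_stable; left.
- by apply: lp_normal_stable; right.
- apply: (hom_trivial_on_gens (f := phi \o psi)) => i.
  by apply/lp_normal_sub/subR; left; exists i.
- apply: (hom_trivial_on_gens (f := psi \o phi)) => i.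
  by apply/lp_normal_sub/subR; right; exists i.
Qed.

End TorusRelators.

(** * Kernels of maps onto the integers *)

Section PositiveWords.
Variables (G : groupType) (f : {multiplicative G -> Zgroup}) (t a : G).
Hypotheses (fa : f a = 1) (ft_inj : injective (fun n => f t ^+ n)).

Let pword (w : seq bool) : G := \prod_(c <- w) (if c then t else t * a).
Let conjs k : set G := [set a ^ (t ^+ j) | j in [set j | j < k]%N].

Let pword_cons c w :
  pword (c :: w) = (if c then t else t * a) * pword w.
Proof. exact: big_cons. Qed.

Lemma pword_normal_form w :
  exists2 b, generated (conjs (size w)) b & pword w = t ^+ size w * b.
Proof.
elim: w => [|c w [b gb pw]].
  by exists 1; [exact: generated1|rewrite /pword big_nil mulg1].
have gb' : generated (conjs (size w).+1) b.
  apply: generated_sub gb => _ [j /= ltj <-]; apply: generated_in.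
  by exists j => //=; exact: leqW.
rewrite pword_cons pw; case: c => /=.
  by exists b; rewrite // mulgA -expgS.
exists (a ^ (t ^+ size w) * b).
  by apply: generatedM => //; apply: generated_in; exists (size w) => /=.
by rewrite expgS /conjg -!mulgA mulVKg.
Qed.

Lemma pword_size u v : pword u = pword v -> size u = size v.
Proof.
have fw w : f (pword w) = f t ^+ size w.
  elim: w => [|c w IHw]; first by rewrite /pword big_nil hom1.
  by rewrite pword_cons gmulfM IHw expgS; case: c; rewrite // gmulfM fa mulg1.
by move=> uv; apply: ft_inj; rewrite /= -!fw uv.
Qed.

(** At the first differing letter, [t * (t ^+ k * b') = t * a * (t ^+ k * b)]
    with [b], [b'] products of conjugates of exponent below [k], so that
    [a ^ (t ^+ k) = b' * b^-1]. *)
Lemma pword_relation u v : u <> v -> pword u = pword v ->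
  exists k, generated (conjs k) (a ^ (t ^+ k)).
Proof.
move=> neq_uv eq_uv; have := pword_size eq_uv.
elim: u v neq_uv eq_uv => [|c u IHu] [|d v] //= neq_uv eq_uv [szuv].
move: eq_uv; have [eq_cd|neq_cd] := eqVneq c d.
  rewrite !pword_cons eq_cd => /mulgI eq_uv; apply: IHu eq_uv szuv => eq_uv.
  by apply: neq_uv; rewrite eq_cd eq_uv.
rewrite !pword_cons.
have [b gb ->] := pword_normal_form u; have [b' gb' ->] := pword_normal_form v.
rewrite -{}szuv in gb' *; move=> eq_uv; exists (size u).
have gbV := generatedV gb; have gbV' := generatedV gb'.
have move_a y : t * a * (t ^+ size u * y) =
    t * (t ^+ size u * (a ^ (t ^+ size u) * y)).
  by rewrite /conjg -!mulgA mulVKg.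
case: c d {neq_uv} neq_cd eq_uv => [] [] // _; rewrite move_a => /mulgI/mulgI.
- by move=> eq_b; have := generatedM gb gbV'; rewrite eq_b mulgK.
- by move=> eq_b; have := generatedM gb' gbV; rewrite -eq_b mulgK.
Qed.

(** A relation [a ^ (t ^+ k)] in terms of the conjugates below [k] propagates
    upwards under conjugation by [t]. *)
Lemma positive_conjugates : ~ contains_free_semigroup2 G ->
  exists k, forall j, generated (conjs k) (a ^ (t ^+ j)).
Proof.
move=> nofree; have [k gk] : exists k, generated (conjs k) (a ^ (t ^+ k)).
  apply: contrapT => nok; apply: nofree; exists t, (t * a) => u v _ _ eq_uv.
  by apply: contrapT => neq_uv; apply: nok; exact: pword_relation eq_uv.
exists k; elim=> [|j IHj].
  by case: k gk => // k _; apply: generated_in; exists 0.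
rewrite expgSr conjgM; apply: generatedJ IHj => _ [i /= lti <-].
rewrite -conjgM -expgSr; move: lti; rewrite leq_eqVlt => /orP[/eqP->//|lti].
by apply: generated_in; exists i.+1.
Qed.

End PositiveWords.

Section IndicableKernel.
Variables (G : groupType) (f : {multiplicative G -> Zgroup}) (t : G).
Hypothesis ft : f t = (1%R : int).

Lemma zpow_section z : f (zpow t z) = z.
Proof.
apply: (eq_hom_generated (f := f \o zpow t) (g := idfun)
  (S := [set (1%R : int) : Zgroup])).
  by move=> _ /set_mem ->; rewrite /= -[LHS]/(f (zpow t (1%R : int))) zpow1.
by rewrite inE; exact: Zgroup_generated.
Qed.

(** The powers of [t^-1] supply the conjugates with negative exponent. *)
Lemma conjugates_fg a : ~ contains_free_semigroup2 G -> f a = 1 ->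
  exists s : seq G, (forall y, y \in s -> exists z, y = a ^ zpow t z) /\
    forall z, generated [set` s] (a ^ zpow t z).
Proof.
move=> nofree fa.
have zpowX n : t ^+ n = zpow t (Posz n) by rewrite /= iter_mulg_1.
have zpowNX n : t^-1 ^+ n.+1 = zpow t (Negz n) by rewrite -iter_mulg_1.
have ft_inj : injective (fun n => f t ^+ n).
  by move=> m n; rewrite /= -!homX !zpowX !zpow_section => -[].
have ftV_inj : injective (fun n => f t^-1 ^+ n).
  by move=> m n; rewrite /= homV !expVgn => /invg_inj/ft_inj.
have [k genk] := positive_conjugates fa ft_inj nofree.
have [l genl] := positive_conjugates fa ftV_inj nofree.
exists ([seq a ^ (t ^+ j) | j <- iota 0 k] ++
        [seq a ^ (t^-1 ^+ j) | j <- iota 0 l]); split=> [y|[n|n]].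
- rewrite mem_cat => /orP[] /mapP[j _ ->].
    by exists (Posz j); rewrite zpowX.
  by case: j => [|j]; [exists (Posz 0)|exists (Negz j); rewrite zpowNX].
- rewrite -zpowX; apply: generated_sub (genk n) => _ [j /= ltj <-].
  apply: generated_in; rewrite /= mem_cat; apply/orP; left.
  by apply: map_f; rewrite mem_iota.
- rewrite -zpowNX; apply: generated_sub (genl n.+1) => _ [j /= ltj <-].
  apply: generated_in; rewrite /= mem_cat; apply/orP; right.
  by apply: (map_f (fun j => a ^ (t^-1 ^+ j))); rewrite mem_iota.
Qed.

Lemma kernel_fg (X : finType) (p : {multiplicative freeGroup X -> G}) :
  (forall g, exists w, p w = g) -> ~ contains_free_semigroup2 G ->
  exists s : seq G, forall x, f x = 1 <-> generated [set` s] x.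
Proof.
move=> p_surj nofree.
(* [g * (zpart g)^-1] is the component of [g] in [ker f]. *)
pose zpart g : G := zpow t (f g).
have f_ker g : f (g * (zpart g)^-1) = 1.
  by rewrite gmulfM homV zpow_section mulgV.
pose a x := p (free_gen x) * (zpart (p (free_gen x)))^-1.
have [s hs] := choice (fun x => conjugates_fg nofree (f_ker (p (free_gen x)))).
pose L := generated [set` flatten [seq s x | x <- enum X]].
have L_conj x z : L (a x ^ zpow t z).
  have [_ /(_ z)] := hs x; apply: generated_sub => y /= ys.
  by apply: generated_in; apply/flatten_mapP; exists x; rewrite ?mem_enum.
have L_gen y : y \in flatten [seq s x | x <- enum X] ->
    exists x z, y = a x ^ zpow t z.
  move=> /flatten_mapP[x _ ys]; have [/(_ y ys) [z ->] _] := hs x.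
  by exists x, z.
have LJ z y : L y -> L (y ^ zpow t z).
  apply: generatedJ => u /L_gen [x [z' ->]].
  by rewrite -conjgM -gmulfM; exact: L_conj.
(* The elements with kernel component in [L] form a subgroup since the powers
   of [t] normalize [L]. *)
have L_all g : L (g * (zpart g)^-1).
  have [w <-] := p_surj g.
  elim: (free_generated w) => {w} [|_ [x _ <-]|u v _ Lu _ Lv|u _ Lu].
  - by rewrite /zpart !hom1 invg1 mulg1; exact: generated1.
  - by have := L_conj x 1; rewrite hom1 conjg1.
  - have := generatedM Lu (LJ (f (p u))^-1 _ Lv); rewrite /zpart homV /conjg.
    by rewrite !gmulfM !invgM !invgK !mulgA mulgVK.
  - have := LJ (f (p u)) _ (generatedV Lu); rewrite /zpart /conjg.
    by rewrite !homV !invgM !invgK !mulgA mulVg mul1g.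
exists (flatten [seq s x | x <- enum X]) => x; split=> [fx1|].
  by have := L_all x; rewrite /zpart fx1 hom1 invg1 mulg1.
elim=> {x} [|y /L_gen [x [z ->]]|x y _ fx _ fy|x _ fx].
- exact: hom1.
- by rewrite homJ f_ker conj1g.
- by rewrite gmulfM fx fy mulg1.
- by rewrite homV fx invg1.
Qed.

End IndicableKernel.

(** * Finitely presented extensions by the integers *)

Lemma hom_lift_through (I : choiceType) (G : groupType)
    (theta sigma : {multiplicative freeGroup I -> G}) :
  (forall i, exists w, theta w = sigma (free_gen i)) ->
  exists phi : {multiplicative freeGroup I -> freeGroup I},
    forall x, theta (phi x) = sigma x.
Proof.
move=> /choice[w thetaw]; exists (free_lift w) => x.
apply: (eq_hom_generated (f := theta \o free_lift w)
  (S := range (@free_gen I))).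
  by move=> _ /set_mem [i _ <-]; rewrite -thetaw -(free_liftE w).
by rewrite inE; exact: free_generated.
Qed.

Section CyclicExtension.
Variables (G : groupType) (f : {multiplicative G -> Zgroup}) (t : G).
Hypotheses (Gfp : finitely_presented G) (ft : f t = (1%R : int)).
Variables (I : finType) (theta : {multiplicative freeGroup I -> G}).
Hypothesis theta_im : forall x, f x = 1 <-> exists w, theta w = x.

Lemma conj_lift u :
  exists phi : {multiplicative freeGroup I -> freeGroup I},
    forall x, theta (phi x) = theta x ^ u.
Proof.
have JM : {morph (fun x => theta x ^ u) : x y / x * y}.
  by move=> x y; rewrite gmulfM conjMg.
apply: (hom_lift_through (sigma := mk_hom JM)) => i.
have /theta_im f1 : exists w, theta w = theta (free_gen i).
  by exists (free_gen i).
by apply/theta_im; rewrite homJ f1 conj1g.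
Qed.

(** The kernel of the comparison between the torus on the inverse relators and
    [G] is normally generated by the finite set [S]; the relators [R] add to
    the inverse ones the [F]-components of the elements of [S]. *)
Lemma cyclic_extension :
  exists (H : groupType) (act : autAction Zgroup H),
    isomorphic G (semidirect act) /\ has_ascending_finite_Lpresentation H.
Proof.
have [phi theta_phi] := conj_lift (zpow t (1%R : int))^-1.
have [psi theta_psi] := conj_lift (zpow t (1%R : int)).
pose Phi := [set phi; psi].
have ker_stable R : R `<=` kernel theta -> lp_normal Phi R `<=` kernel theta.
  apply: lp_normal_min => _ x [->|->] /= thx.
    by rewrite theta_phi thx conj1g.
  by rewrite theta_psi thx conj1g.
pose R0 := inverse_relators phi psi.
have R0_ker : R0 `<=` kernel theta.
  move=> _ [] [i _ <-] /=; apply/hom_divP.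
    by rewrite theta_phi theta_psi conjgK.
  by rewrite theta_psi theta_phi conjgKV.
have theta_torus R (kerR : R `<=` kernel theta) (subR : R0 `<=` R) :=
  torus_liftE (lp_inverse_modulo subR) (ker_stable R kerR) theta_phi theta_psi.
have G_split g : exists x z, g = theta x * zpow t z.
  have /theta_im[x thx] : f (g * (zpow t (f g))^-1) = 1.
    by rewrite gmulfM homV zpow_section // mulgV.
  by exists x, (f g); rewrite thx mulgVK.
pose inv0 := lp_inverse_modulo (@subset_refl _ R0).
pose lift0 := torus_lift inv0 (ker_stable R0 R0_ker) theta_phi theta_psi.
have lift0E : forall x z,
  lift0 (torus_proj inv0 x * torus_shift inv0 z) = theta x * zpow t z.
  exact: theta_torus.
pose A := range (torus_proj inv0 \o @free_gen I)
  `|` [set torus_shift inv0 (1%R : int)].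
have [|||S [finS kerS]] := @kernel_finite_ncl G (torus inv0) A lift0 Gfp.
- rewrite finite_setU; split; last exact: finite_set1.
  exact/finite_image/finite_finset.
- move=> y; rewrite (torus_split y); apply: generatedM.
    apply: (generated_hom _ (free_generated _)) => _ [i _ <-].
    by apply: generated_in; left; exists i.
  apply: (generated_hom _ (Zgroup_generated _)) => _ ->.
  by apply: generated_in; right.
- by move=> g; have [x [z ->]] := G_split g; rewrite -lift0E; eexists.
have split1 x z : theta x * zpow t z = 1 -> theta x = 1 /\ z = 1.
  move=> thz; have z1 : z = 1.
    have /theta_im fx : exists w, theta w = theta x by exists x.
    by have := congr1 f thz; rewrite gmulfM fx zpow_section // mul1g hom1.
  by move: thz; rewrite z1 hom1 mulg1.
(* Elements of the kernel of [lift0] have trivial integer component, so their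
   components in the quotient of [F] determine them. *)
pose R := R0 `|` [set repr y.1 | y in S].
have kerR : R `<=` kernel theta.
  move=> _ [/R0_ker//|[y Sy <-]].
  have /kerS : ncl S y by exact: ncl_sub.
  by rewrite {1}(torus_split y) lift0E => /split1[].
have subR : R0 `<=` R by move=> x; left.
pose inv := lp_inverse_modulo subR.
pose lift := torus_lift inv (ker_stable R kerR) theta_phi theta_psi.
have liftE : forall x z,
  lift (torus_proj inv x * torus_shift inv z) = theta x * zpow t z.
  exact: theta_torus.
have ker_theta x : theta x = 1 -> nsg_set (lp_normal Phi R) x.
  have N0_ker u : nsg_set (lp_normal Phi R0) u -> torus_proj inv u = 1.
    move=> N0u; apply/torus_projE; apply: lp_normal_min N0u => [h v|v R0v].
      exact: lp_normal_stable.
    by apply/lp_normal_sub/subR.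
  (* [compare] kills [S], hence the kernel of [lift0], which contains the
     image of [x]. *)
  pose compare :=
    torus_lift inv0 N0_ker (torus_proj_phi inv) (torus_proj_psi inv).
  have compareE u z : compare (torus_proj inv0 u * torus_shift inv0 z) =
    torus_proj inv u * torus_shift inv z by exact: torus_liftE.
  have S_ker : S `<=` kernel compare.
    move=> y Sy; change (compare y = 1); have /kerS : ncl S y by exact: ncl_sub.
    rewrite (torus_split y) lift0E => /split1[_ y2]; rewrite compareE.
    rewrite y2 hom1 mulg1; apply/torus_projE/lp_normal_sub.
    by right; exists y.
  move=> thx; apply/(torus_projE inv).
  have proj0 : torus_proj inv0 x = torus_proj inv0 x * torus_shift inv0 1.
    by rewrite hom1 mulg1.
  have /kerS/(_ (kernel compare) S_ker) : lift0 (torus_proj inv0 x) = 1.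
    by rewrite proj0 lift0E thx hom1 mulg1.
  change (compare (torus_proj inv0 x) = 1 -> torus_proj inv x = 1).
  by rewrite proj0 compareE hom1 mulg1.
exists (quotientGroup (lp_normal Phi R)), (torus_action inv); split.
  have lift_inj : injective lift.
    apply: hom_inj => y; rewrite (torus_split y) liftE => /split1[thx ->].
    by rewrite hom1 mulg1; apply/torus_projE/ker_theta.
  have /choice[unlift unliftK] : forall g, exists y, lift y = g.
    by move=> g; have [x [z ->]] := G_split g; rewrite -liftE; eexists.
  have liftK : cancel lift unlift by move=> y; apply: lift_inj; rewrite unliftK.
  exists (mk_hom (can2_gmulfM liftK unliftK)).
  by exists lift.
pose P := {| lp_X := I; lp_Q := set0; lp_R := R; lp_Phi := Phi |}.
exists P; split=> //; last by exists idfun; exists idfun.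
split=> /=.
- exact: finite_finset.
- exact: finite_set0.
- rewrite /R !finite_setU; split; last exact: finite_image.
  by split; apply/finite_image/finite_finset.
- by rewrite /Phi finite_setU; split; exact: finite_set1.
Qed.

End CyclicExtension.

Theorem theorem2 (G : groupType) (hfp : finitely_presented G)
    (hind : indicable G) (hfree : ~ contains_free_semigroup2 G) :
  exists (H : groupType) (theta : autAction Zgroup H),
    isomorphic G (semidirect theta) /\ has_ascending_finite_Lpresentation H.
Proof.
have [f f_surj] := hind; have [t ft] := f_surj (1%R : int).
have [X [R [p [_ p_surj _]]]] := fp_cover hfp.
have [s kerf] := kernel_fg ft p_surj hfree.
pose theta := free_lift (fun i : seq_sub s => val i).
apply: (cyclic_extension hfp ft (theta := theta)) => x; rewrite kerf.
split=> [gx|[w <-]].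
  elim: gx => {x} [|x sx|x y _ [u <-] _ [v <-]|x _ [u <-]].
  - by exists 1; exact: hom1.
  - by exists (free_gen (SeqSub sx)); rewrite free_liftE.
  - by exists (u * v); exact: gmulfM.
  - by exists u^-1; exact: homV.
apply: (generated_hom _ (free_generated w)) => _ [i _ <-].
by rewrite free_liftE; apply/generated_in/(valP i).
Qed.
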